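(* Let $d=1$, $Y=\mathbb{R}$, and let $F$, the partitions $\{A_j^m(x)\}_{j=0}^m$, the sequences $h_m,\delta_m,\sigma_m>0$ and constants $\sigma_0,r>0$ (none depending on $x$) and the model $p(y|x,\mathcal{M}_4)$ be as described in the context. Suppose: (a) for some $p_m\in(0,m^{-1}]$ not depending on $x$: $F(A_j^m(x)|x)=p_m$ for $j>0$, $F(A_0^m(x)|x)=1-mp_m$, and $mp_m\to1$; (b) $\delta_m\to0$, $\sigma_m/\delta_m\to0$, $h_m/\sigma_m\to0$; (c) $f(y|x)$ is positive and continuously differentiable in $y$ on $\mathbb{R}$ for all $x$, and the second moments of $y$ are finite; (d) for any $(y,x)$, with $C_r(y)=[y-r/2,y+r/2]$, there exists $M$ such that for any $m\ge M$: if $y\in A_0^m(x)$, then $C_r(y)\cap A_0^m(x)$ contains an interval with an end at $y$ and length $r/2$; and if $y\in Y\setminus A_0^m(x)$, then $C_r(y)\cap(Y\setminus A_0^m(x))$ contains an interval with an end at $y$ and length $r/2$; (e) $\displaystyle\int\sup_{z\in C_r(y)}\Big\|\frac{d\log f(z|x)}{dz}\Big\|F(dy,dx)<\infty$; (f) $1>1/4>\phi(y,0,\sigma_0)\,r/2$ for all $y$. Then for all sufficiently large $m$, $$\begin{aligned}d_{\mathrm{KL}}(F,\mathcal{M}_4)\le{}&\delta_m\cdot\frac{d^{1/2}}{2}\int\sup_{z\in C_{\delta_m}(y)}\Big\|\frac{d\log f(z|x)}{dz}\Big\|F(dy,dx)\\&+2\,\frac{3h_m}{(2\pi)^{1/2}\sigma_m}+2\exp\Big\{-\frac{(\delta_m/\sigma_m)^2}{8}\Big\}\\&+\frac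 r2\int_{B_{\delta_m}(A_0^m(x))}\sup_{z\in C_r(y)}\Big\|\frac{d\log f(z|x)}{dz}\Big\|F(dy,dx)\\&+\int_{B_{\delta_m}(A_0^m(x))}\Big[\frac{y'y}{2\sigma_0^2}-\log\frac{(r/2)}{(2\pi\sigma_0^2)^{1/2}}\Big]F(dy,dx),\end{aligned}$$ where $d=1$ and $B_{\delta_m}(A_0^m(x))=\{(y,x):C_{\delta_m}(y)\cap A_0^m(x)\ne\varnothing\}$, and the terms of this bound converge to zero as $m\to\infty$.
   Context: $F$ is a probability distribution on $Y\times X$, $Y=\mathbb{R}$, $X\subset\mathbb{R}^{d_x}$. The conditional distribution of $y$ given $x$ has a density $f(y|x)$ with respect to Lebesgue measure $\lambda$; the marginal of $x$ has a density $f(x)$ with respect to some generic measure. $F(A|x)=\int_A f(y|x)\,dy$. $\phi(y,\mu,\sigma)$ is the density at $y$ of the normal distribution with mean $\mu$ and standard deviation $\sigma$. $C_\delta(y)$ is the interval with center $y$ and length $\delta$. For a model $\mathcal{M}$ with conditional density $p(y|x,\mathcal{M})$, $$d_{\mathrm{KL}}(F,\mathcal{M})=\int\log\frac{f(y|x)}{p(y|x,\mathcal{M})}\,F(dy,dx).$$ For each $x$ and $m$, $A_j^m(x)$, $j=0,1,\dots,m$, is a partition of $Y$ such that $A_1^m(x),\dots,A_m^m(x)$ are intervals and $\bigcup_{j=1}^mA_j^m(x)$ is an interval that is nondecreasing in $m$. $h_m\ge\max_{j>0}\lambda(A_j^m(x))$ for all $x$. $\mu_j^m(x)\in A_j^m(x)$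 for $j>0$. $\sigma_0$ does not depend on $m$. The model is $$p(y|x,\mathcal{M}_4)=\sum_{j=1}^mF(A_j^m(x)|x)\,\phi(y,\mu_j^m(x),\sigma_m)+F(A_0^m(x)|x)\,\phi(y,0,\sigma_0).$$ *)

(* Defs.v *)
From HB Require Import structures.
From mathcomp Require Export all_boot all_order all_algebra.
From mathcomp Require Export all_classical all_reals all_analysis.

Set Implicit Arguments.
Unset Strict Implicit.
Unset Printing Implicit Defensive.

Export Order.TTheory GRing.Theory Num.Theory.
Export numFieldNormedType.Exports.

Local Open Scope classical_set_scope.
Local Open Scope ring_scope.

Section definitions.
Context {R : realType} {dx : nat}.

(* [F] is a law of (y, x) on R * X, where X is a Borel set of R^dx. The space
   R^dx is [dx.-tuple R], whose sigma-algebra is generated by the coordinates.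
   [f y x] is the density of y given x with respect to Lebesgue measure, and
   [fX] the density of x with respect to an arbitrary measure [nu]. *)
Definition has_densities (X : set (dx.-tuple R))
    (F : probability (R * dx.-tuple R)%type R)
    (f : R -> dx.-tuple R -> R)
    (nu : {measure set (dx.-tuple R) -> \bar R}) (fX : dx.-tuple R -> R) :=
  [/\ measurable X,
      measurable_fun ([set: R] `*` X) (fun z => f z.1 z.2) /\
        measurable_fun X fX,
      forall x, X x -> 0 <= fX x /\ forall y, 0 <= f y x,
      forall x, X x -> (\int[lebesgue_measure]_y (f y x)%:E = 1)%E &
      forall S, measurable S -> F S =
        (\int[nu]_(x in X)
           ((fX x)%:E * \int[lebesgue_measure]_(y in ysection S x) (f y x)%:E))%E].

Definition cond_prob (f : R -> dx.-tuple R -> R) (B : set R)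
    (x : dx.-tuple R) : R :=
  \int[lebesgue_measure]_(y in B) f y x.

(* Real logarithm of a real quotient: meaningful only where [f] and [p] are
   positive. *)
Definition dKL (X : set (dx.-tuple R))
    (F : probability (R * dx.-tuple R)%type R)
    (f p : R -> dx.-tuple R -> R) : \bar R :=
  (\int[F]_(z in [set: R] `*` X) (ln (f z.1 z.2 / p z.1 z.2))%:E)%E.

Definition centered_interval (delta y : R) : set R :=
  `[y - delta / 2, y + delta / 2]%classic.

Definition sup_dlog (f : R -> dx.-tuple R -> R) (delta y : R)
    (x : dx.-tuple R) : \bar R :=
  ereal_sup [set (`|((fun u => ln (f u x))^`())%classic z|)%:E
            | z in centered_interval delta y].

(* Whatever endpoints it includes, an interval with an end at [y] and length
   [l] contains one of these two open intervals. *)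
Definition contains_interval_ending_at (l y : R) (S : set R) :=
  (`]y - l, y[%classic `<=` S) \/ (`]y, y + l[%classic `<=` S).

(* [A m j x] is the cell A_j^m(x), for m >= 1 and j = 0, ..., m. *)
Definition fine_part (A : nat -> nat -> dx.-tuple R -> set R) (m : nat)
    (x : dx.-tuple R) : set R :=
  \bigcup_(j in [set j | (0 < j <= m)%N]) A m j x.

(* The last two fields are the measurability in x that makes the model
   jointly measurable in (y, x) and the set [near_tail] below measurable. *)
Record partition_scheme (X : set (dx.-tuple R))
    (A : nat -> nat -> dx.-tuple R -> set R) (h : nat -> R)
    (mu : nat -> nat -> dx.-tuple R -> R) : Prop := {
  scheme_partition : forall m x, (0 < m)%N -> X x ->
    partition [set j | (j <= m)%N] (fun j => A m j x) [set: R] ;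
  scheme_cell_interval : forall m j x, (0 < j <= m)%N -> X x ->
    is_interval (A m j x) ;
  scheme_fine_interval : forall m x, (0 < m)%N -> X x ->
    is_interval (fine_part A m x) ;
  scheme_fine_nondecreasing : forall m n x, (0 < m <= n)%N -> X x ->
    fine_part A m x `<=` fine_part A n x ;
  scheme_cell_length : forall m j x, (0 < j <= m)%N -> X x ->
    (lebesgue_measure (A m j x) <= (h m)%:E)%E ;
  scheme_center : forall m j x, (0 < j <= m)%N -> X x -> A m j x (mu m j x) ;
  scheme_center_measurable : forall m j, (0 < j <= m)%N ->
    measurable_fun X (mu m j) ;
  scheme_tail_measurable : forall m, (0 < m)%N ->
    measurable [set z : R * dx.-tuple R | X z.2 /\ A m 0%N z.2 z.1]
}.

Definition model4 (f : R -> dx.-tuple R -> R)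
    (A : nat -> nat -> dx.-tuple R -> set R)
    (mu : nat -> nat -> dx.-tuple R -> R) (sigma : nat -> R) (sigma0 : R)
    (m : nat) (y : R) (x : dx.-tuple R) : R :=
  \sum_(1 <= j < m.+1)
     cond_prob f (A m j x) x * normal_pdf (mu m j x) (sigma m) y
  + cond_prob f (A m 0%N x) x * normal_pdf 0 sigma0 y.

Definition near_tail (X : set (dx.-tuple R))
    (A : nat -> nat -> dx.-tuple R -> set R) (delta : nat -> R) (m : nat) :
    set (R * dx.-tuple R) :=
  [set z | X z.2 /\ centered_interval (delta m) z.1 `&` A m 0%N z.2 !=set0].

End definitions.

(* Main.v *)
Require Import Defs.
From mathcomp Require Import measurable_realfun ring lra.

(** Let I be the fine part of the partition at x: an interval whose
    complement is the tail cell. Two estimates turn the Kullback-Leibler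
    distance into elementary bounds at each (y, x).

    - The function ln f(.|x) is Lipschitz on C_a(y) with constant
      S = sup |d log f|, so f(.|x) >= c on C_a(y) for
      c = f(y|x) exp (- (a/2) S). Hence p(y|x) >= c k implies
      ln (f/p) <= (a/2) S - ln k ([ln_ratio_le_sup]).

    - A fine cell has weight the integral of f over it, and its centre is
      within h of all its points. So the mixture at y is at least the
      integral of f(z) K(z) over any part of I, where K(z) is the centred
      normal density at |z - y| + h ([mixture_ge]). Over an interval of length
      t with an end at y, K has integral at least
      (1 - exp (- (t/sigma)^2/2)) / 2 - h / (sqrt (2 pi) sigma), by the
      Gaussian tail bound ([integral_offset_kernel_right]).

    It remains to choose k in each region.

    - If C_delta(y) does not meet the tail cell, then it lies in I and both
      halves of it count: k = 1 - u with
      u = exp (- (delta/sigma)^2/8) + 2 h / (sqrt (2 pi) sigma), and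
      - ln (1 - u) <= 2 u is at most the sum of the second and third terms.

    - If y is in the tail cell, then so is a half-line starting at y, because
      the cell is the complement of an interval; the weight of the cell is
      thus at least c r/2, and k = phi(y, 0, sigma_0) r/2.

    - If y is in I but C_delta(y) meets the tail cell, then k = 1/4, which
      exceeds the previous value, also works for large m. When I extends by
      2 sigma on some side of y, the integral of K on that side is at
      least 1/4. Otherwise I lies within 2 sigma of y while it carries the
      mass m p_m >= 1/2, so that the mixture is of order 1 / sigma at y; and
      c <= 1/r, because f(.|x) integrates to 1. This dichotomy makes the
      threshold on m the same for all (y, x).

    Integrating the far bound over the whole space, and the near bound over
    the near-tail set, yields the inequality. The last two terms vanish by
    dominated convergence: the weight of the tail cell tends to 0 and f is
    positive and continuous, so every y is eventually interior to I, away
    from its ends. *)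

Set Implicit Arguments.
Unset Strict Implicit.
Unset Printing Implicit Defensive.

Local Open Scope classical_set_scope.
Local Open Scope ring_scope.

(** * The normal distribution *)

Section normal_bounds.
Context {R : realType}.
Implicit Types m s t y h : R.
Let leb := @lebesgue_measure R.

Lemma normal_pdf_le m m' s y y' : s != 0 -> `|y - m| <= `|y' - m'| ->
  normal_pdf m' s y' <= normal_pdf m s y.
Proof.
move=> s0 le; rewrite !normal_pdfE// ler_pM2l ?normal_peak_gt0//.
rewrite /normal_fun ler_expR !mulNr lerN2 ler_pM2r; last first.
  by rewrite invr_gt0 pmulrn_lgt0// exprn_even_gt0.
by rewrite -(real_normK (num_real (y - m))) -(real_normK (num_real (y' - m'))) lerXn2r ?nnegrE.
Qed.

Lemma normal_peakE s : 0 < s -> normal_peak s = (Num.sqrt (2 * pi) * s)^-1.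
Proof.
move=> s0; rewrite /normal_peak; congr (_^-1).
rewrite -mulrnAr -mulr_natl sqrtrM ?sqr_ge0// sqrtr_sqr gtr0_norm//.
by rewrite mulrC.
Qed.

Lemma integral_shift_itvcy (G : R -> R) (a t : R) :
  continuous G -> (forall x, 0 <= G x) ->
  (\int[leb]_(x in `[(a + t)%R, +oo[) (G x)%:E =
   \int[leb]_(x in `[a, +oo[) (G (x + t)%R)%:E)%E.
Proof.
move=> cG G0.
have d1 : (fun x : R => x + t)^`()%classic = cst 1.
  by apply/funext => x; rewrite derive1E deriveD// derive_id derive_cst addr0.
rewrite (@increasing_ge0_integration_by_substitutiony _ (fun x => x + t))//.
- by apply: eq_integral => x _; rewrite !fctE d1 /= mulr1.
- by move=> x z _ _; rewrite ltrD2r.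
- by rewrite d1 => x _; exact: cst_continuous.
- by rewrite d1; exact: is_cvg_cst.
- by rewrite d1; exact: is_cvg_cst.
- split => //; apply: cvg_at_right_filter; apply: cvgD; [exact: cvg_id|exact: cvg_cst].
- exact: cvg_addrr.
- exact: continuous_subspaceT.
Qed.

Lemma normal_prob_half m s : s != 0 ->
  normal_prob m s `[m, +oo[ = (2^-1)%:E.
Proof.
move=> s0; rewrite /normal_prob -{1}(add0r m) integral_shift_itvcy; last 2 first.
  exact: continuous_normal_pdf.
  by move=> x; exact: normal_pdf_ge0.
have -> : (\int[leb]_(x in `[0%R, +oo[) (normal_pdf m s (x + m)%R)%:E =
           \int[leb]_(x in `[0%R, +oo[) (normal_pdf 0 s x)%:E)%E.
  by apply: eq_integral => x _; rewrite !normal_pdfE// /normal_fun addrK subr0.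
have := @integral_normal_pdf R 0 s.
rewrite ge0_symfun_integralT//=; last 3 first.
- by move=> x; exact: normal_pdf_ge0.
- exact: continuous_normal_pdf.
- by move=> x /=; rewrite !normal_pdfE// /normal_fun !subr0 sqrrN.
rewrite (_ : [set x | _] = `[0, +oo[%classic); last first.
  by apply/seteqP; split => x/=; rewrite in_itv/= andbT.
set I := (\int[_]_(_ in _) _)%E => I1.
have If : I \is a fin_num.
  case: I I1 => [r _|I1|I1]; first exact: erefl.
  by move: I1; rewrite gt0_muley ?lte_fin.
  by move: I1; rewrite gt0_muleNy ?lte_fin.
by move: I1; rewrite -(fineK If) -EFinM => -[I1]; congr EFin; lra.
Qed.

(** For x >= m one has (x + t - m)^2 >= (x - m)^2 + t^2: after translating by
    t, the tail integrand is at most exp (- (t/s)^2/2) times the density, whose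
    integral over the half-line is 1/2. *)
Lemma normal_prob_upper_tail m s t : s != 0 -> 0 <= t ->
  (normal_prob m s `[(m + t)%R, +oo[ <=
   (2^-1 * expR (- (t / s) ^+ 2 / 2))%:E)%E.
Proof.
move=> s0 t0; rewrite /normal_prob integral_shift_itvcy; last 2 first.
  exact: continuous_normal_pdf.
  by move=> x; exact: normal_pdf_ge0.
rewrite mulrC EFinM -(normal_prob_half m s0) /normal_prob.
rewrite -ge0_integralZl_EFin ?expR_ge0//; last 2 first.
- by move=> x _; rewrite lee_fin normal_pdf_ge0.
- by apply/measurable_EFinP/measurable_funTS; exact: measurable_normal_pdf.
apply: ge0_le_integral => //.
- by move=> x _; rewrite lee_fin normal_pdf_ge0.
- apply/measurable_EFinP/measurable_funTS.
  apply: continuous_measurable_fun => x.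
  apply: (@continuous_comp _ _ _ (fun x => x + t) (normal_pdf m s));
    last exact: continuous_normal_pdf.
  by apply: cvgD; [exact: cvg_id|exact: cvg_cst].
- apply: measurable_funeM.
  by apply/measurable_EFinP/measurable_funTS; exact: measurable_normal_pdf.
move=> x /=; rewrite in_itv/= andbT => mx.
rewrite -EFinM lee_fin !normal_pdfE// mulrCA ler_pM2l ?normal_peak_gt0//.
rewrite /normal_fun -expRD ler_expR -mulrnAr expr_div_n.
have s2 : 0 < s ^+ 2 by rewrite exprn_even_gt0.
rewrite -(mulr_natr _ 2) -subr_ge0.
rewrite (_ : _ - _ = (x - m) * t / s ^+ 2); last by field; rewrite ?s0.
apply: divr_ge0; last exact: ltW.
by apply: mulr_ge0 => //; rewrite subr_ge0.
Qed.

(** The half-line from m - h, of mass 1/2, is covered by [m - h, m], on which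
    the density is at most its peak, by [m, m + t], and by a tail starting
    further than t from the mean. *)
Lemma normal_prob_right m s t h : s != 0 -> 0 <= t -> 0 <= h ->
  ((2^-1 * (1 - expR (- (t / s) ^+ 2 / 2)) - h * normal_peak s)%:E <=
   normal_prob (m - h)%R s `[m, (m + t)%R])%E.
Proof.
move=> s0 t0 h0.
set P : probability _ _ := normal_prob (m - h) s.
have cover : `[(m - h)%R, +oo[%classic `<=`
    `[(m - h)%R, m]%classic `|` `[m, (m + t)%R]%classic `|` `[(m - h + t)%R, +oo[%classic.
  move=> x /=; rewrite !in_itv/= !andbT => hx.
  have [xm|mx] := leP x m; first by left; left; rewrite hx.
  have [xt|tx] := leP x (m + t); first by left; right; rewrite ltW.
  by right; rewrite (le_trans _ (ltW tx))// lerD2r gerBl.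
have Phalf : P `[(m - h)%R, +oo[%classic = (2^-1)%:E by exact: normal_prob_half.
have Ph : (P `[(m - h)%R, m]%classic <= (h * normal_peak s)%:E)%E.
  rewrite /P /= /normal_prob.
  apply: (@le_trans _ _ (\int[leb]_(x in `[(m - h)%R, m]) (normal_peak s)%:E)%E).
    apply: ge0_le_integral => //.
    - by move=> x _; rewrite lee_fin normal_pdf_ge0.
    - by apply/measurable_EFinP/measurable_funTS; exact: measurable_normal_pdf.
    - by move=> x _; rewrite lee_fin normal_pdf_ub.
  rewrite integral_cst//= lebesgue_measure_itv/= lte_fin.
  case: ifPn => _.
    by rewrite -EFinB -EFinM lee_fin opprB addrC subrK mulrC.
  by rewrite mule0 lee_fin mulr_ge0 ?normal_peak_ge0.
have Pt := normal_prob_upper_tail (m - h) s0 t0.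
have : (P `[(m - h)%R, +oo[%classic <= P `[(m - h)%R, m]%classic + P `[m, (m + t)%R]%classic
    + P `[(m - h + t)%R, +oo[%classic)%E.
  apply: (le_trans (le_measure P _ _ cover)); rewrite ?inE//.
    by apply: measurableU => //; apply: measurableU.
  apply: (le_trans (measureU2 _ _ _)) => //; first exact: measurableU.
  by rewrite leeD2r// measureU2.
rewrite Phalf; move: Ph Pt; rewrite -/P.
have : P `[m, (m + t)%R]%classic \is a fin_num by exact: fin_num_measure.
have : P `[(m-h)%R, m]%classic \is a fin_num by exact: fin_num_measure.
have : P `[(m-h+t)%R, +oo[%classic \is a fin_num by exact: fin_num_measure.
change (normal_prob (m - h)%R s) with (P : set _ -> \bar R).
move=> /fineK <- /fineK <- /fineK <-.
rewrite -!EFinD !lee_fin; lra.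
Qed.

Lemma normal_prob_left m s t h : s != 0 -> 0 <= t -> 0 <= h ->
  ((2^-1 * (1 - expR (- (t / s) ^+ 2 / 2)) - h * normal_peak s)%:E <=
   normal_prob (m + h)%R s `[(m - t)%R, m])%E.
Proof.
move=> s0 t0 h0.
suff -> : (normal_prob (m + h)%R s `[(m - t)%R, m] =
           normal_prob (- m - h)%R s `[(- m)%R, (- m + t)%R])%E.
  exact: normal_prob_right.
rewrite /normal_prob.
have := @integration_by_substitution_oppr R (normal_pdf (m + h) s) (- m) (- m + t).
rewrite opprD opprK => ->; last 2 first.
- by rewrite lerDl.
- by apply: continuous_subspaceT; exact: continuous_normal_pdf.
apply: eq_integral => x _; congr EFin.
have e : (- x - (m + h)) ^+ 2 = (x - (- m - h)) ^+ 2 by ring.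
by rewrite !(normal_pdfE _ s0) /normal_fun [LHS]/= e.
Qed.
End normal_bounds.

(** * Mixtures dominate an offset kernel *)

Section offset_kernel.
Context {R : realType}.
Implicit Types s h y z t : R.
Let leb := @lebesgue_measure R.

(** The smallest value at y of a normal density whose centre is within h of z. *)
Definition offset_kernel s h y z : R := normal_pdf 0 s (`|z - y| + h).

Lemma offset_kernel_ge0 s h y z : 0 <= offset_kernel s h y z.
Proof. exact: normal_pdf_ge0. Qed.

Lemma measurable_offset_kernel s h y : measurable_fun setT (offset_kernel s h y).
Proof.
apply: (measurableT_comp (measurable_normal_pdf _ _)).
apply: measurable_funD => //; apply: measurableT_comp => //.
exact: measurable_funB.
Qed.

Lemma offset_kernel_le s h y z u : s != 0 -> `|u - z| <= h ->
  offset_kernel s h y z <= normal_pdf u s y.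
Proof.
move=> s0 uz; apply: normal_pdf_le => //; rewrite subr0.
rewrite [leRHS]ger0_norm; last by rewrite addr_ge0// (le_trans _ uz).
rewrite (_ : y - u = - ((z - y) + (u - z))); last by ring.
by rewrite normrN (le_trans (ler_normD _ _))// lerD2l.
Qed.

Lemma integral_offset_kernel_right s h y t : s != 0 -> 0 <= t -> 0 <= h ->
  ((2^-1 * (1 - expR (- (t / s) ^+ 2 / 2)) - h * normal_peak s)%:E <=
   \int[leb]_(z in `[y, (y + t)%R]) (offset_kernel s h y z)%:E)%E.
Proof.
move=> s0 t0 h0; rewrite (le_trans (normal_prob_right y s0 t0 h0))//.
rewrite /normal_prob le_eqVlt; apply/orP; left; apply/eqP/eq_integral => z.
rewrite inE/= in_itv/= => /andP[yz _].
rewrite /offset_kernel !(normal_pdfE _ s0) /normal_fun ger0_norm ?subr_ge0//.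
by rewrite subr0 opprB addrA addrAC.
Qed.

Lemma integral_offset_kernel_left s h y t : s != 0 -> 0 <= t -> 0 <= h ->
  ((2^-1 * (1 - expR (- (t / s) ^+ 2 / 2)) - h * normal_peak s)%:E <=
   \int[leb]_(z in `[(y - t)%R, y]) (offset_kernel s h y z)%:E)%E.
Proof.
move=> s0 t0 h0; rewrite (le_trans (normal_prob_left y s0 t0 h0))//.
rewrite /normal_prob le_eqVlt; apply/orP; left; apply/eqP/eq_integral => z.
rewrite inE/= in_itv/= => /andP[_ zy].
rewrite /offset_kernel !(normal_pdfE _ s0) /normal_fun ler0_norm ?subr_le0//.
by rewrite subr0 -(sqrrN (z - _)) !opprB addrAC.
Qed.

Lemma integral_offset_kernel s h y t : s != 0 -> 0 <= t -> 0 <= h ->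
  ((1 - expR (- (t / s) ^+ 2 / 2) - 2 * h * normal_peak s)%:E <=
   \int[leb]_(z in `[(y - t)%R, (y + t)%R]) (offset_kernel s h y z)%:E)%E.
Proof.
move=> s0 t0 h0.
have mK D : measurable_fun D (EFin \o offset_kernel s h y).
  by apply/measurable_EFinP/measurable_funTS; exact: measurable_offset_kernel.
have -> : `[(y - t)%R, (y + t)%R]%classic = `[y - t, y] `|` `]y, y + t].
  rewrite -itv_bndbnd_setU// bnd_simp.
    by rewrite gerBl.
  by rewrite lerDl.
rewrite ge0_integral_setU//; last 3 first.
- exact: mK.
- by move=> z _; rewrite lee_fin offset_kernel_ge0.
- apply/disj_setPRL => z /=; rewrite !in_itv/= => /andP[yz _].
  by apply/negP; rewrite negb_and -!ltNge yz orbT.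
rewrite integral_itv_obnd_cbnd; last exact: mK.
apply: le_trans (leeD (integral_offset_kernel_left y s0 t0 h0)
  (integral_offset_kernel_right y s0 t0 h0)).
by rewrite -EFinD lee_fin; lra.
Qed.

End offset_kernel.

Section mixture.
Context {R : realType}.
Let leb := @lebesgue_measure R.
Implicit Types (g : R -> R) (B : nat -> set R).

Lemma le_lebesgue_dist (I : set R) (l u v : R) : is_interval I ->
  (leb I <= l%:E)%E -> I u -> I v -> `|u - v| <= l.
Proof.
move=> iI Il.
wlog uv : u v / u <= v.
  move=> H Iu Iv; have [uv|/ltW vu] := leP u v; first exact: H.
  by rewrite distrC; apply: H.
move=> Iu Iv; rewrite ler0_norm ?subr_le0// opprB -lee_fin.
apply: le_trans Il; apply: (@le_trans _ _ (leb `[u, v])).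
  by rewrite /leb lebesgue_measure_itv/= lte_fin; case: ltgtP uv => // -> _; rewrite subrr.
apply: le_measure; rewrite ?inE//=; first exact: is_interval_measurable.
by move=> z /=; rewrite in_itv/=; exact: iI.
Qed.

(** Each weight is split as an integral over its cell; on the cell the component
    at y dominates the offset kernel, since the centre is within h of
    each point. Summing over the disjoint cells leaves the integral over J. *)
Lemma mixture_ge g B (m : nat) (h s c y : R) (mu : nat -> R) (J : set R) :
  s != 0 -> 0 <= c ->
  measurable_fun setT g -> (forall z, 0 <= g z) ->
  leb.-integrable setT (EFin \o g) ->
  trivIset [set j | (0 < j <= m)%N] B ->
  (forall j, (0 < j <= m)%N -> is_interval (B j)) ->
  (forall j, (0 < j <= m)%N -> (leb (B j) <= h%:E)%E) ->
  (forall j, (0 < j <= m)%N -> B j (mu j)) ->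
  measurable J ->
  J `<=` \bigcup_(j in [set j | (0 < j <= m)%N]) B j ->
  (forall z, J z -> c <= g z) ->
  (c%:E * \int[leb]_(z in J) (offset_kernel s h y z)%:E <=
  (\sum_(1 <= j < m.+1)
     (\int[leb]_(z in B j) g z) * normal_pdf (mu j) s y)%:E)%E.
Proof.
move=> s0 c0 mg g0 ig tB iB lB muB mJ JB cg.
have mK D : measurable_fun D (EFin \o offset_kernel s h y).
  by apply/measurable_EFinP/measurable_funTS; exact: measurable_offset_kernel.
pose C j := if (0 < j <= m)%N then J `&` B j else set0.
have mC j : measurable (C j).
  rewrite /C; case: ifPn => // jm; apply: measurableI => //.
  by apply: is_interval_measurable; exact: iB.
have mem j : (j \in index_iota 1 m.+1) = (0 < j <= m)%N by rewrite mem_index_iota ltnS.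
have JE : J = \big[setU/set0]_(j <- index_iota 1 m.+1) C j.
  rewrite -bigcup_seq; apply/seteqP; split => z.
    by move=> Jz; have [j jm Bjz] := JB _ Jz; exists j; rewrite /= ?mem// /C; move: jm => /= ->.
  by move=> [j /=]; rewrite mem /C => -> [].
rewrite -ge0_integralZl_EFin//; last 2 first.
- by move=> z _; rewrite lee_fin offset_kernel_ge0.
- exact: mK.
rewrite JE ge0_integral_bigsetU ?iota_uniq//=; last 3 first.
- move=> i j /=; rewrite !mem /C => im jm; rewrite im jm => -[z [[_ Bi] [_ Bj]]].
  by apply: tB => //; exists z.
- by apply: measurable_funeM; exact: mK.
- by move=> z _; rewrite -EFinM lee_fin mulr_ge0// offset_kernel_ge0.
rewrite -sumEFin big_seq [leRHS]big_seq; apply: lee_sum => j; rewrite mem => jm.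
have mBj : measurable (B j) by apply: is_interval_measurable; exact: iB.
have wE : ((\int[leb]_(z in B j) g z)%:E = \int[leb]_(z in B j) (g z)%:E)%E.
  rewrite fineK//; apply: integrable_fin_num => //.
  exact: (integrableS _ _ (@subsetT _ _) ig).
rewrite EFinM wE muleC -ge0_integralZl_EFin//; last 3 first.
- by move=> z _; rewrite lee_fin.
- exact/measurable_EFinP/measurable_funTS.
- exact: normal_pdf_ge0.
apply: (@le_trans _ _ (\int[leb]_(z in C j) ((normal_pdf (mu j) s y)%:E * (g z)%:E))%E).
  apply: ge0_le_integral => //; first exact: mC.
  - by move=> z _; rewrite -EFinM lee_fin mulr_ge0// offset_kernel_ge0.
  - by apply: measurable_funeM; exact: mK.
  - by apply: measurable_funeM; exact/measurable_EFinP/measurable_funTS.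
  move=> z; rewrite /C jm => -[Jz Bz]; rewrite -!EFinM lee_fin mulrC.
  apply: ler_pM => //; [exact: offset_kernel_ge0| |exact: cg].
  apply: offset_kernel_le => //; apply: (@le_lebesgue_dist (B j)) => //.
  - exact: iB.
  - exact: lB.
  - exact: muB.
apply: ge0_subset_integral => //; first exact: mC.
- by apply: measurable_funeM; exact/measurable_EFinP/measurable_funTS.
- by move=> z _; rewrite -EFinM lee_fin mulr_ge0// normal_pdf_ge0.
- by rewrite /C jm; exact: subIsetr.
Qed.

(** Points of I on both sides of y would put y in I. *)
Lemma interval_complement_ray (I : set R) (y : R) : is_interval I -> ~ I y ->
  `[y, +oo[ `<=` ~` I \/ `]-oo, y] `<=` ~` I.
Proof.
move=> iI nIy; apply: contrapT => /not_orP[/existsNP[u /not_implyP[yu /contrapT Iu]]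
  /existsNP[v /not_implyP[vy /contrapT Iv]]].
apply: nIy; apply: (iI v u) => //.
by move: yu vy; rewrite /= !in_itv/= andbT => -> ->.
Qed.

End mixture.

(** * Lower bounds for the mixture at a fixed covariate *)

Lemma derivable_ln_comp (R : realType) (g : R -> R) (z : R) : 0 < g z ->
  derivable g z 1 ->
  is_derive z 1 (fun u => ln (g u)) ((g z)^-1 * g^`()%classic z).
Proof.
move=> gz dg.
have dln : is_derive (g z) 1 (@ln R) (g z)^-1 by exact: is_derive1_ln.
have dg' : is_derive z 1 g (g^`()%classic z) by rewrite derive1E; exact/derivableP.
by have := is_derive1_comp dln dg'; rewrite mulrC.
Qed.

(** The mean value theorem for the logarithm of g. *)
Lemma log_lipschitz_lower (R : realType) (g : R -> R) (a S y z : R) :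
  (forall u, 0 < g u) -> (forall u, derivable g u 1) ->
  (forall u, y - a <= u <= y + a -> `|(fun v => ln (g v))^`()%classic u| <= S) ->
  y - a <= z <= y + a ->
  g y * expR (- (a * S)) <= g z.
Proof.
move=> g0 dg bS zC.
set G := (fun v => ln (g v)).
have dG (u : R) : is_derive u 1 G (G^`()%classic u).
  have := derivable_ln_comp (g0 u) (dg u) => dGu.
  by rewrite derive1E; apply/derivableP; exact: ex_derive.
have cG : continuous (G : R -> R).
  by move=> u; apply/differentiable_continuous/derivable1_diffP; exact: ex_derive.
suff : `|G y - G z| <= a * S.
  move=> GS; rewrite -(@lnK _ (g y)) ?posrE// -(@lnK _ (g z)) ?posrE//.
  by rewrite -expRD ler_expR; move: GS; rewrite /G ler_norml => /andP[_]; lra.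
have S0 : 0 <= S by apply: le_trans (bS y _); rewrite ?normr_ge0//; lra.
have [yz|/ltW zy] := leP y z.
- have [c /=] := @MVT_segment _ G _ _ _ yz (fun u _ => dG u) (continuous_subspaceT cG).
  rewrite in_itv/= => cyz e; rewrite distrC e normrM mulrC ler_pM//.
    by rewrite ger0_norm; lra.
  by apply: bS; lra.
- have [c /=] := @MVT_segment _ G _ _ _ zy (fun u _ => dG u) (continuous_subspaceT cG).
  rewrite in_itv/= => cyz e; rewrite e normrM mulrC ler_pM//.
    by rewrite ger0_norm; lra.
  by apply: bS; lra.
Qed.

(** Converts a lower bound on the approximating density P into an upper bound
    on the log-ratio: the oscillation of the log-density enters through L, the
    quality of the approximation through k. *)
Lemma ln_ratio_le (R : realType) (a k L P : R) : 0 < a -> 0 < k ->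
  a * expR (- L) * k <= P -> ln (a / P) <= L - ln k.
Proof.
move=> a0 k0 le.
have P0 : 0 < P by apply: lt_le_trans le; rewrite !mulr_gt0// expR_gt0.
rewrite ln_div ?posrE//.
have : ln (a * expR (- L) * k) <= ln P by rewrite ler_ln ?posrE// !mulr_gt0// expR_gt0.
rewrite lnM ?posrE ?mulr_gt0 ?expR_gt0// lnM ?posrE ?expR_gt0// expRK; lra.
Qed.

Lemma expRN2_le (R : realType) : expR (- 2) <= (4^-1 : R).
Proof.
rewrite expRN lef_pV2 ?posrE ?expR_gt0//.
have := expR_ge1Dx (1 : R) => e1.
by rewrite (_ : 2 = 1 + 1) ?expRD//; nra.
Qed.

Section fixed_covariate.
Context {R : realType}.
Let leb := @lebesgue_measure R.
Variables (g : R -> R) (B : nat -> set R) (m : nat) (h s p : R) (mu : nat -> R).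
Let I := \bigcup_(j in [set j | (0 < j <= m)%N]) B j.
Let mix y := \sum_(1 <= j < m.+1)
     (\int[leb]_(z in B j) g z) * normal_pdf (mu j) s y.

Hypotheses (g0 : forall z, 0 < g z) (dg : forall z, derivable g z 1)
  (g1 : (\int[leb]_z (g z)%:E = 1)%E)
  (pB : partition [set j | (j <= m)%N] B [set: R])
  (iB : forall j, (0 < j <= m)%N -> is_interval (B j))
  (iI : is_interval I)
  (lB : forall j, (0 < j <= m)%N -> (leb (B j) <= h%:E)%E)
  (muB : forall j, (0 < j <= m)%N -> B j (mu j))
  (s0 : 0 < s) (h0 : 0 < h).

Lemma density_measurable : measurable_fun setT g.
Proof.
apply: continuous_measurable_fun => z.
exact/differentiable_continuous/derivable1_diffP.
Qed.

Lemma density_integrable : leb.-integrable setT (EFin \o g).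
Proof.
apply/integrableP; split; first by apply/measurable_EFinP; exact: density_measurable.
rewrite (_ : (\int[_]_(_ in _) _)%E = 1%E) ?ltry// -g1.
by apply: eq_integral => z _; rewrite /= ger0_norm// ltW.
Qed.

Lemma density_integral_lower (J D : set R) (c : R) : 0 <= c ->
  measurable J -> measurable D -> J `<=` D -> (forall z, J z -> c <= g z) ->
  (c%:E * leb J <= \int[leb]_(z in D) (g z)%:E)%E.
Proof.
move=> c0 mJ mD JD cg; rewrite -integral_cst//.
apply: (@le_trans _ _ (\int[leb]_(z in J) (g z)%:E)%E).
  apply: ge0_le_integral => //.
  - by apply/measurable_EFinP/measurable_funTS; exact: density_measurable.
apply: ge0_subset_integral => //.
- by apply/measurable_EFinP/measurable_funTS; exact: density_measurable.
- by move=> z _; rewrite lee_fin ltW.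
Qed.

Lemma tail_cellE : B 0%N = ~` I.
Proof.
have [cB tB _] := pB.
apply/seteqP; split => z.
  move=> B0 [j /= /andP[j0 jm] Bj].
  by have e : 0%N = j by [apply: tB => //; exists z]; rewrite -e in j0.
move=> nI; have : cover [set j | (j <= m)%N] B z by rewrite cB.
case=> -[//|j] jm Bj; exfalso; apply: nI; exists j.+1 => //.
Qed.

Lemma cells_trivIset : trivIset [set j | (0 < j <= m)%N] B.
Proof.
have [_ tB _] := pB; move=> i j /andP[_ im] /andP[_ jm]; exact: tB.
Qed.

Lemma mix_lower (c y : R) (J : set R) : 0 <= c -> measurable J -> J `<=` I ->
  (forall z, J z -> c <= g z) ->
  (c%:E * \int[leb]_(z in J) (offset_kernel s h y z)%:E <= (mix y)%:E)%E.
Proof.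
move=> c0 mJ JI cg; apply: mixture_ge => //.
- by rewrite gt_eqF.
- exact: density_measurable.
- by move=> z; exact: ltW.
- exact: density_integrable.
- exact: cells_trivIset.
Qed.

(** Both halves of C_d(y) contribute: (d/2/s)^2/2 = (d/s)^2/8. *)
Lemma mix_lower_far (c y d : R) : 0 <= c -> 0 <= d -> I (y - d / 2) -> I (y + d / 2) ->
  (forall z, y - d / 2 <= z <= y + d / 2 -> c <= g z) ->
  c * (1 - expR (- ((d / s) ^+ 2 / 8)) - 2 * h * normal_peak s) <= mix y.
Proof.
move=> c0 d0 Il Ir cg; rewrite -lee_fin.
have s1 : s != 0 by rewrite gt_eqF.
have d2 : 0 <= d / 2 by lra.
have JI : `[y - d / 2, y + d / 2] `<=` I by move=> z /=; rewrite in_itv/=; exact: iI.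
have Jc z : `[y - d / 2, y + d / 2]%classic z -> c <= g z by rewrite /= in_itv/=; exact: cg.
apply: le_trans (mix_lower y c0 (measurable_itv _) JI Jc).
rewrite EFinM lee_wpmul2l ?lee_fin//.
apply: le_trans (integral_offset_kernel y s1 d2 (ltW h0)).
rewrite lee_fin; suff -> : - (d / 2 / s) ^+ 2 / 2 = - ((d / s) ^+ 2 / 8) by [].
by field.
Qed.

(** The tail cell is the complement of an interval, so it contains a half-line
    starting at y, hence one of the two halves of C_r(y). *)
Lemma tail_mass_lower (c y r : R) : 0 <= c -> 0 < r -> B 0%N y ->
  (forall z, y - r / 2 <= z <= y + r / 2 -> c <= g z) ->
  c * (r / 2) <= \int[leb]_(z in B 0%N) g z.
Proof.
move=> c0 r0; rewrite tail_cellE => nIy cg.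
have mI : measurable (~` I) by apply: measurableC; apply: is_interval_measurable.
rewrite -lee_fin fineK; last first.
  apply: integrable_fin_num => //.
  exact: (integrableS _ _ (@subsetT _ _) density_integrable).
rewrite EFinM.
have [ray|ray] := interval_complement_ray iI nIy.
- have -> : ((r / 2)%:E = leb `[y, (y + r / 2)%R]%classic)%E.
    rewrite /leb lebesgue_measure_itv/= lte_fin ltrDl divr_gt0//.
    by rewrite -EFinD addrAC subrr add0r.
  apply: density_integral_lower => //.
    by move=> z /=; rewrite in_itv/= => /andP[yz _]; apply: ray; rewrite /= in_itv/= yz.
  by move=> z /=; rewrite in_itv/= => /andP[yz zr]; apply: cg; lra.
- have -> : ((r / 2)%:E = leb `[(y - r / 2)%R, y]%classic)%E.
    rewrite /leb lebesgue_measure_itv/= lte_fin gtrBl divr_gt0//.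
    by rewrite -EFinB opprB addrC subrK.
  apply: density_integral_lower => //.
    by move=> z /=; rewrite in_itv/= => /andP[_ yz]; apply: ray; rewrite /= in_itv/= yz.
  by move=> z /=; rewrite in_itv/= => /andP[yz zr]; apply: cg; lra.
Qed.

Lemma density_lower_bound_le (c y r : R) : 0 <= c -> 0 < r ->
  (forall z, y - r / 2 <= z <= y + r / 2 -> c <= g z) -> c * r <= 1.
Proof.
move=> c0 r0 cg; rewrite -lee_fin -g1 EFinM.
have -> : (r%:E = leb `[(y - r / 2)%R, (y + r / 2)%R]%classic)%E.
  rewrite /leb lebesgue_measure_itv/= lte_fin ifT; last by lra.
  by rewrite -EFinB; congr EFin; lra.
by apply: density_integral_lower => // z /=; rewrite in_itv/=; exact: cg.
Qed.

(** Either the fine part extends by 2 s on one side of y, and that side alone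
    contributes 1/4; or all the centres are within 2 s of y, and the mixture is
    at least its total weight times exp (-2) times the peak. The latter is large
    when s is small, whereas c is at most 1/r. *)
Lemma mix_lower_fine (c y r : R) : 0 <= c -> 0 < r -> I y ->
  (forall j, (0 < j <= m)%N -> \int[leb]_(z in B j) g z = p) ->
  0 <= p -> 2 * s <= r / 2 -> h * normal_peak s <= 8^-1 ->
  (4 * r)^-1 <= m%:R * p * (expR (- 2) * normal_peak s) ->
  (forall z, y - r / 2 <= z <= y + r / 2 -> c <= g z) ->
  c / 4 <= mix y.
Proof.
move=> c0 r0 Iy wp p0 sr hs large cg.
have s1 : s != 0 by rewrite gt_eqF.
have s2 : 0 <= 2 * s by rewrite mulr_ge0 ?ltW.
have e : - (2 * s / s) ^+ 2 / 2 = - 2 by rewrite mulfK//; field.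
have half : 4^-1 <= 2^-1 * (1 - expR (- (2 * s / s) ^+ 2 / 2)) - h * normal_peak s.
  by rewrite e; have := expRN2_le R; lra.
have [Ir|nIr] := pselect (I (y + 2 * s)).
  rewrite -lee_fin.
  have JI : `[y, y + 2 * s] `<=` I by move=> z /=; rewrite in_itv/=; exact: iI.
  have Jc z : `[y, y + 2 * s]%classic z -> c <= g z.
    by rewrite /= in_itv/= => ?; apply: cg; lra.
  apply: le_trans (mix_lower y c0 (measurable_itv _) JI Jc).
  rewrite EFinM lee_wpmul2l ?lee_fin//.
  apply: le_trans (integral_offset_kernel_right y s1 s2 (ltW h0)).
  by rewrite lee_fin.
have [Il|nIl] := pselect (I (y - 2 * s)).
  rewrite -lee_fin.
  have JI : `[y - 2 * s, y] `<=` I by move=> z /=; rewrite in_itv/=; exact: iI.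
  have Jc z : `[y - 2 * s, y]%classic z -> c <= g z.
    by rewrite /= in_itv/= => ?; apply: cg; lra.
  apply: le_trans (mix_lower y c0 (measurable_itv _) JI Jc).
  rewrite EFinM lee_wpmul2l ?lee_fin//.
  apply: le_trans (integral_offset_kernel_left y s1 s2 (ltW h0)).
  by rewrite lee_fin.
(* Neither y - 2 s nor y + 2 s is in the interval I, which contains y. *)
have near j : (0 < j <= m)%N -> `|y - mu j| <= 2 * s.
  move=> jm; have Ij : I (mu j) by exists j => //; exact: muB.
  rewrite ler_norml; apply/andP; split; rewrite leNgt; apply/negP => lt.
    by apply: nIr; apply: (iI Iy Ij); lra.
  by apply: nIl; apply: (iI Ij Iy); lra.
apply: (@le_trans _ _ (4 * r)^-1).
  have := density_lower_bound_le c0 r0 cg => cr.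
  by rewrite invfM mulrC ler_pM2l// -div1r ler_pdivlMr.
apply: (le_trans large).
rewrite /mix.
have -> : m%:R * p * (expR (- 2) * normal_peak s) =
    \sum_(1 <= j < m.+1) p * (expR (- 2) * normal_peak s).
  by rewrite sumr_const_nat subSS subn0 -[RHS]mulr_natl !mulrA.
rewrite big_nat [leRHS]big_nat; apply: ler_sum => j; rewrite ltnS => jm.
rewrite wp// ler_wpM2l// (normal_pdfE _ s1) mulrC ler_wpM2l ?normal_peak_ge0//.
rewrite /normal_fun ler_expR.
have s20 : 0 < s ^+ 2 by rewrite exprn_gt0.
rewrite mulNr lerN2 ler_pdivrMr ?pmulrn_lgt0//.
have -> : 2 * (s ^+ 2 *+ 2) = (2 * s) ^+ 2 by rewrite -mulr_natr; ring.
by rewrite -real_normK ?num_real// lerXn2r ?nnegrE ?near.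
Qed.

End fixed_covariate.

(** * The local supremum of the log-derivative *)

(** Clipping to [a, b] turns the rational points of the line into a countable
    dense subset of [a, b] that depends measurably on a and b. A supremum over a
    moving interval thus becomes a countable supremum. *)

Section clip.
Context {R : realType}.
Implicit Types a b t : R.

Definition clip a b t : R := Num.max a (Num.min b t).

Lemma clip_itv a b t : a <= b -> a <= clip a b t <= b.
Proof.
by move=> ab; rewrite /clip le_max lexx/= ge_max ab ge_min lexx.
Qed.

Lemma clip_id a b t : a <= t <= b -> clip a b t = t.
Proof. by move=> /andP[at_ tb]; rewrite /clip (min_idPr tb) (max_idPr at_). Qed.

Lemma continuous_clip a b : continuous (clip a b).
Proof.
move=> t; apply: (@continuous_max R R (cst a) (fun t => Num.min b t)).
  exact: cst_continuous.
apply: (@continuous_min R R (cst b) id); first exact: cst_continuous.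
exact: cvg_id.
Qed.

Lemma ereal_sup_clip_rat (H : R -> R) a b : a <= b -> continuous H ->
  ereal_sup [set (H z)%:E | z in `[a, b]] =
  ereal_sup (range (fun q : rat => (H (clip a b (ratr q)))%:E)).
Proof.
move=> ab cH; apply/eqP; rewrite eq_le; apply/andP; split; last first.
  apply: ge_ereal_sup => _ [q _ <-]; apply: ereal_sup_ubound => /=.
  by exists (clip a b (ratr q)) => //; rewrite in_itv/= clip_itv.
apply: ge_ereal_sup => _ [z /= zab <-]; rewrite leNgt; apply/negP => lt.
have [v sv vz] : exists2 v,
    (ereal_sup (range (fun q : rat => (H (clip a b (ratr q)))%:E)) <= v%:E)%E &
    v < H z.
  move: lt; case: ereal_sup => [v| |]; first by rewrite lte_fin => ?; exists v.
    by [].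
  by move=> _; exists (H z - 1); rewrite ?leNye// gtrBl.
have oO : open [set t | v < H (clip a b t)].
  apply: (@open_comp _ _ (H \o clip a b) [set u | v < u]); last exact: open_gt.
  by move=> t _; apply: continuous_comp; [exact: continuous_clip|exact: cH].
have [|u [/= vq [q _ qE]]] := dense_rat _ oO; first by exists z; rewrite /= clip_id.
have : ((H (clip a b (ratr q)))%:E <= v%:E)%E.
  by apply: le_trans sv; apply: ereal_sup_ubound; exists q.
by rewrite qE lee_fin leNgt vq.
Qed.
End clip.

Lemma measurable_ereal_sup_rat d (T : measurableType d) (R : realType) (D : set T)
    (F : rat -> T -> \bar R) :
  (forall q, measurable_fun D (F q)) ->
  measurable_fun D (fun t => ereal_sup (range (F ^~ t))).
Proof.
move=> mF; pose G n := F (odflt 0 (unpickle n)).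
have -> : (fun t => ereal_sup (range (F ^~ t))) = (fun t => esups (G ^~ t) 0%N).
  apply/funext => t; rewrite /esups/=; congr ereal_sup; apply/seteqP; split.
    by move=> _ [q _ <-]; exists (pickle q) => //; rewrite /G pickleK.
  by move=> _ [n _ <-]; exists (odflt 0 (unpickle n)).
by apply: measurable_fun_esups => n; exact: mF.
Qed.

Section sup_dlog.
Context {R : realType} {dx : nat}.
Variables (X : set (dx.-tuple R)) (f : R -> dx.-tuple R -> R).
Let D : set (R * dx.-tuple R) := [set: R] `*` X.
Hypotheses (mX : measurable X)
  (mf : measurable_fun D (fun z => f z.1 z.2))
  (f0 : forall x, X x -> forall y, 0 < f y x)
  (df : forall x, X x -> forall y, derivable (f ^~ x) y 1)
  (cf : forall x, X x -> continuous (derive1 (f ^~ x))).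

Let dlog (z : R * dx.-tuple R) : R := (fun u => ln (f u z.2))^`()%classic z.1.

Lemma measurable_band : measurable D.
Proof. exact: measurableX. Qed.

Lemma measurable_vertical_map (phi : R -> R) (U : R -> dx.-tuple R -> R) :
  measurable_fun setT phi -> measurable_fun D (fun z => U z.1 z.2) ->
  measurable_fun D (fun z => U (phi z.1) z.2).
Proof.
move=> mphi mU.
apply: (@measurable_comp _ _ _ _ _ _ D (fun z => U z.1 z.2) D
  (fun z => (phi z.1, z.2))) => //.
- exact: measurable_band.
- by move=> _ [z [_ Xz] <-].
apply: measurable_funTS; apply: measurable_fun_pair => //.
exact: measurableT_comp.
Qed.

Lemma derivable_log x : X x -> forall y : R,
  is_derive y 1 (fun u => ln (f u x)) (dlog (y, x)).
Proof.
move=> Xx y; rewrite /dlog /= derive1E; apply/derivableP.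
by have [] := derivable_ln_comp (f0 Xx y) (@df _ Xx y).
Qed.

Lemma continuous_dlog x : X x -> continuous (fun y => dlog (y, x)).
Proof.
move=> Xx.
have -> : (fun y => dlog (y, x)) = (fun y => (f y x)^-1 * (f ^~ x)^`()%classic y).
  apply/funext => y; rewrite /dlog/= derive1E.
  by have [] := derivable_ln_comp (f0 Xx y) (@df _ Xx y).
move=> y; apply: cvgM; last exact: cf.
apply: cvgV; first by rewrite gt_eqF// f0.
exact/differentiable_continuous/derivable1_diffP/df.
Qed.

(** The log-derivative is a pointwise limit of difference quotients with step
    1/(n+1), each of which is jointly measurable. *)
Lemma measurable_dlog : measurable_fun D dlog.
Proof.
pose e n : R := n.+1%:R^-1.
pose h (n : nat) (z : R * dx.-tuple R) : R :=
  (e n)^-1 * (ln (f (z.1 + e n) z.2) - ln (f z.1 z.2)).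
apply: (measurable_fun_cvg (h := h)).
- move=> n; apply: measurable_funM => //; apply: measurable_funB.
    apply: (measurableT_comp (@measurable_ln R)).
    apply: (@measurable_vertical_map (fun y => y + e n)) => //.
    exact: measurable_funD.
  exact: (measurableT_comp (@measurable_ln R)).
move=> [y x] [_ /= Xx].
have := derivable_log Xx y => d1.
have : (fun h => h^-1 *: (ln (f (h *: 1 + y) x) - ln (f y x))) @ 0^' --> dlog (y, x).
  by case: d1; rewrite /derive => ? <-.
move=> /cvgr_dnbhsP /(_ e) H.
rewrite [X in X @ _](_ : _ =
  (fun h : R => h^-1 *: (ln (f (h *: 1 + y) x) - ln (f y x))) \o e); last first.
  by apply/funext => n; rewrite /h [RHS]/= /GRing.scale/= mulr1 (addrC (e n)).
apply: H; split; first by move=> n; rewrite /e gt_eqF// invr_gt0.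
exact: cvg_harmonic.
Qed.

Lemma sup_dlog_ge (a y z : R) x : y - a / 2 <= z <= y + a / 2 ->
  ((`|dlog (z, x)|)%:E <= sup_dlog f a y x)%E.
Proof.
move=> yz; apply: ereal_sup_ubound; exists z => //.
Qed.

Lemma sup_dlog_ge0 (a y : R) x : 0 <= a -> (0 <= sup_dlog f a y x)%E.
Proof.
move=> a0; apply: (@le_trans _ _ (`|dlog (y, x)|)%:E); first by rewrite lee_fin.
by apply: sup_dlog_ge; lra.
Qed.

Lemma le_sup_dlog (a b y : R) x : a <= b -> (sup_dlog f a y x <= sup_dlog f b y x)%E.
Proof.
move=> ab; apply: le_ereal_sup => _ [z + <-].
rewrite /centered_interval /= in_itv/= => yz; exists z => //=.
by rewrite /centered_interval /= in_itv/=; lra.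
Qed.

Lemma measurable_sup_dlog (a : R) : 0 <= a ->
  measurable_fun D (fun z => sup_dlog f a z.1 z.2).
Proof.
move=> a0.
pose G (q : rat) (z : R * dx.-tuple R) : \bar R :=
  (`|dlog (clip (z.1 - a / 2) (z.1 + a / 2) (ratr q), z.2)|)%:E.
apply: (@eq_measurable_fun _ _ _ _ _ (fun z => ereal_sup (range (G ^~ z)))).
  move=> [y x]; rewrite inE => -[_ /= Xx].
  rewrite /sup_dlog /centered_interval.
  rewrite -(@ereal_sup_clip_rat _ (fun u => `|dlog (u, x)|))//; first by lra.
  by move=> u; apply: cvg_norm; exact: continuous_dlog.
apply: measurable_ereal_sup_rat => q; apply/measurable_EFinP.
apply: measurableT_comp => //.
apply: (@measurable_vertical_map (fun y => clip (y - a / 2) (y + a / 2) (ratr q))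
  (fun y x => dlog (y, x))).
  apply: measurable_maxr; first exact: measurable_funB.
  by apply: measurable_minr => //; exact: measurable_funD.
apply: eq_measurable_fun measurable_dlog.
by case.
Qed.

(** When the supremum is infinite there is nothing to prove; otherwise
    c = f(y|x) exp (- (a/2) sup) bounds the density from below on C_a(y). *)
Lemma ln_ratio_le_sup (a k y P : R) x : X x -> 0 < a -> 0 < k ->
  (forall c, 0 <= c -> (forall z, y - a / 2 <= z <= y + a / 2 -> c <= f z x) ->
     c * k <= P) ->
  ((ln (f y x / P))%:E <= (a / 2)%:E * sup_dlog f a y x - (ln k)%:E)%E.
Proof.
move=> Xx a0 k0 H.
have := @sup_dlog_ge0 a y x (ltW a0).
have : forall z, y - a / 2 <= z <= y + a / 2 -> ((`|dlog (z, x)|)%:E <= sup_dlog f a y x)%E.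
  by move=> z; exact: sup_dlog_ge.
case: (sup_dlog f a y x) => [S| |] bS // S0; last first.
  rewrite gt0_muley ?lte_fin ?divr_gt0//.
  by rewrite addye// leey.
rewrite -EFinM -EFinB lee_fin; apply: ln_ratio_le => //; first exact: f0.
apply: H; first by rewrite mulr_ge0 ?expR_ge0// ltW// f0.
move=> z yz; apply: (@log_lipschitz_lower _ (f ^~ x)) yz => //.
- exact: f0.
- exact: df.
Qed.

End sup_dlog.

(** * The log-ratio, far from and near the tail cell *)

(** For t <= 1/2 one has 1 / (1 - t) <= 1 + 2 t, and ln (1 + 2 t) <= 2 t. *)
Lemma lnN_1B_le (R : realType) (t : R) : 0 <= t <= 2^-1 -> - ln (1 - t) <= 2 * t.
Proof.
move=> /andP[t0 t2]; have t1 : 0 < 1 - t by lra.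
rewrite -lnV ?posrE//.
have := @le_ln1Dx _ (2 * t : R).
have le : (1 - t)^-1 <= 1 + 2 * t by rewrite -div1r ler_pdivrMr//; nra.
move=> H; apply: le_trans (H _); last by lra.
by rewrite ler_ln ?posrE ?invr_gt0//; lra.
Qed.

Lemma ln_normal_pdf_tail (R : realType) (s r y : R) : 0 < s -> 0 < r ->
  - ln (normal_pdf 0 s y * (r / 2)) =
  y ^+ 2 / (2 * s ^+ 2) - ln (r / 2 / Num.sqrt (2 * pi * s ^+ 2)).
Proof.
move=> s0 r0; have s1 : s != 0 by rewrite gt_eqF.
have pk0 := normal_peak_gt0 s1.
have -> : normal_pdf 0 s y * (r / 2) =
    r / 2 * normal_peak s * expR (- (y ^+ 2 / (2 * s ^+ 2))).
  rewrite (normal_pdfE _ s1) /normal_fun subr0 mulNr -[_ *+ 2]mulr_natl; ring.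
have -> : Num.sqrt (2 * pi * s ^+ 2) = (normal_peak s)^-1.
  by rewrite /normal_peak invrK; congr Num.sqrt; rewrite -mulr_natr; ring.
rewrite invrK lnM ?posrE ?expR_gt0 ?mulr_gt0 ?divr_gt0// expRK; ring.
Qed.

Section scheme.
Context {R : realType} {dx : nat}.
Variables (X : set (dx.-tuple R)) (f : R -> dx.-tuple R -> R)
  (A : nat -> nat -> dx.-tuple R -> set R) (mu : nat -> nat -> dx.-tuple R -> R)
  (h delta sigma p : nat -> R) (sigma0 r : R).
Let D : set (R * dx.-tuple R) := [set: R] `*` X.
Hypotheses
  (f1 : forall x, X x -> (\int[lebesgue_measure]_y (f y x)%:E = 1)%E)
  (hA : partition_scheme X A h mu)
  (hpos : forall m, (0 < m)%N -> [/\ 0 < h m, 0 < delta m & 0 < sigma m])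
  (hsigma0 : 0 < sigma0) (hr : 0 < r)
  (ha_p : forall m, (0 < m)%N -> 0 < p m <= m%:R^-1)
  (ha_cells : forall m j x, (0 < j <= m)%N -> X x ->
      cond_prob f (A m j x) x = p m)
  (ha_tail : forall m x, (0 < m)%N -> X x ->
      cond_prob f (A m 0%N x) x = 1 - m%:R * p m)
  (ha_lim : m%:R * p m @[m --> \oo] --> (1 : R))
  (hb_delta : delta m @[m --> \oo] --> (0 : R))
  (f0 : forall x, X x -> forall y, 0 < f y x)
  (df : forall x, X x -> forall y, derivable (f ^~ x) y 1)
  (hf : forall y, normal_pdf 0 sigma0 y * (r / 2) < (4^-1 : R)).

Lemma scheme_tailE m x : (0 < m)%N -> X x -> A m 0%N x = ~` fine_part A m x.
Proof. by move=> m0 Xx; apply: tail_cellE; exact: (scheme_partition hA). Qed.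

(** An interval contains C_delta(y) as soon as it contains both its ends, so
    only the ends need to be tested against the tail cell. This exhibits the
    near-tail set as a union of two translates, which gives its measurability. *)
Lemma near_tailE m : (0 < m)%N -> near_tail X A delta m =
  [set z | X z.2 /\ A m 0%N z.2 (z.1 + - (delta m / 2))] `|`
  [set z | X z.2 /\ A m 0%N z.2 (z.1 + delta m / 2)].
Proof.
move=> m0; have [_ d0 _] := hpos m0; apply/seteqP; split => -[y x] /=.
- move=> [Xx [u [/=]]]; rewrite /centered_interval/= in_itv/= => yu.
  rewrite (scheme_tailE m0 Xx) => nIu.
  have [Il|nIl] := pselect (fine_part A m x (y + - (delta m / 2))); last by left.
  right; split => // Ir; apply: nIu.
  exact: (scheme_fine_interval hA m0 Xx Il Ir).
- by move=> [[Xx Ay]|[Xx Ay]]; split => //;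
    [exists (y + - (delta m / 2))|exists (y + delta m / 2)]; split => //;
    rewrite /centered_interval/= in_itv/=; lra.
Qed.

Lemma measurable_near_tail m : (0 < m)%N -> measurable (near_tail X A delta m).
Proof.
move=> m0; rewrite near_tailE//.
have mshift (t : R) : measurable [set z : R * dx.-tuple R | X z.2 /\ A m 0%N z.2 (z.1 + t)].
  rewrite -[S in measurable S]setTI.
  have mphi : measurable_fun setT (fun z : R * dx.-tuple R => (z.1 + t, z.2)).
    by apply: measurable_fun_pair => //; exact: measurable_funD.
  exact: (mphi measurableT _ (scheme_tail_measurable hA m0)).
exact: measurableU.
Qed.

Lemma near_tail_sub m : near_tail X A delta m `<=` D.
Proof. by move=> z [Xz _]; split. Qed.

(** If y were in the tail cell for arbitrarily large m, its weight would stay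
    above the minimum of f(.|x) on [y - 1, y + 1]. *)
Lemma eventually_fine x y : X x -> \forall m \near \oo, fine_part A m x y.
Proof.
move=> Xx.
have cfx : continuous (f ^~ x : R -> R).
  by move=> u; apply/differentiable_continuous/derivable1_diffP; exact: df.
have y11 : y - 2 / 2 <= y + 2 / 2 by lra.
have [c _ fc] := EVT_min y11 (continuous_subspaceT cfx).
have : \forall m \near \oo, 1 - f c x < m%:R * p m.
  by apply: (cvgr_gt 1) => //; rewrite gtrBl f0.
move=> pc; near=> m.
have m0 : (0 < m)%N by near: m; exists 1%N.
apply: contrapT => nI.
have /(_ (f c x) y 2) := @tail_mass_lower _ _ _ _
  (f0 Xx) (df Xx) (f1 Xx) (scheme_partition hA m0 Xx)
  (scheme_fine_interval hA m0 Xx).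
rewrite divff// mulr1 -/(cond_prob f (A m 0%N x) x) ha_tail// => H.
have : 1 - f c x < m%:R * p m by near: m.
suff : f c x <= 1 - m%:R * p m by lra.
apply: H => //; first exact/ltW/f0.
- by rewrite scheme_tailE.
- by move=> z yz; apply: fc; rewrite in_itv/=; lra.
Unshelve. all: by end_near. Qed.

Lemma eventually_not_near_tail z : X z.2 ->
  \forall m \near \oo, ~ near_tail X A delta m z.
Proof.
move: z => [y x] /= Xx; near=> m.
have m0 : (0 < m)%N by near: m; exists 1%N.
have Il : fine_part A m x (y - 1) by near: m; exact: eventually_fine.
have Ir : fine_part A m x (y + 1) by near: m; exact: eventually_fine.
have d2 : delta m < 2 by near: m; apply: (cvgr_lt 0).
move=> [_ [u [/=]]]; rewrite /centered_interval/= in_itv/= => yu.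
rewrite (scheme_tailE m0 Xx); apply.
by apply: (scheme_fine_interval hA m0 Xx Il Ir); lra.
Unshelve. all: by end_near. Qed.

Lemma model4_ge m x y (c : R) : (0 < m)%N -> X x ->
  (c <= \sum_(1 <= j < m.+1)
          cond_prob f (A m j x) x * normal_pdf (mu m j x) (sigma m) y \/
   c <= cond_prob f (A m 0%N x) x * normal_pdf 0 sigma0 y) ->
  c <= model4 f A mu sigma sigma0 m y x.
Proof.
move=> m0 Xx H; rewrite /model4.
have s0 : 0 <= \sum_(1 <= j < m.+1)
    cond_prob f (A m j x) x * normal_pdf (mu m j x) (sigma m) y.
  rewrite big_nat; apply: sumr_ge0 => j; rewrite ltnS => jm.
  by rewrite mulr_ge0 ?normal_pdf_ge0// ha_cells// ltW//; case/andP: (ha_p m0).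
have t0 : 0 <= cond_prob f (A m 0%N x) x * normal_pdf 0 sigma0 y.
  rewrite mulr_ge0 ?normal_pdf_ge0// ha_tail// subr_ge0 mulrC -ler_pdivlMr ?ltr0n//.
  by rewrite div1r; case/andP: (ha_p m0).
by case: H => le; [rewrite -[c]addr0|rewrite -[c]add0r]; exact: lerD.
Qed.

(* The second and third terms of the bound. *)
Let t2 m := 2 * (3 * h m / (Num.sqrt (2 * pi) * sigma m)).
Let t3 m := 2 * expR (- ((delta m / sigma m) ^+ 2 / 8)).

Lemma log_ratio_far m x y : (0 < m)%N -> X x -> ~ near_tail X A delta m (y, x) ->
  t2 m + t3 m <= 1 ->
  ((ln (f y x / model4 f A mu sigma sigma0 m y x))%:E <=
   (delta m / 2)%:E * sup_dlog f (delta m) y x + (t2 m + t3 m)%:E)%E.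
Proof.
move=> m0 Xx ntl small; have [h0 d0 s0] := hpos m0.
move: ntl; rewrite near_tailE//= => /not_orP[nl nr].
have Il : fine_part A m x (y - delta m / 2).
  by apply: contrapT => nI; apply: nl; split => //; rewrite scheme_tailE.
have Ir : fine_part A m x (y + delta m / 2).
  by apply: contrapT => nI; apply: nr; split => //; rewrite scheme_tailE.
set t := expR (- ((delta m / sigma m) ^+ 2 / 8)) + 2 * h m * normal_peak (sigma m).
have pk0 := normal_peak_ge0 (sigma m).
have t2E : t2 m = 6 * (h m * normal_peak (sigma m)).
  by rewrite /t2 normal_peakE//; ring.
have hp0 : 0 <= h m * normal_peak (sigma m) by rewrite mulr_ge0// ltW.
have e0 := expR_gt0 (- ((delta m / sigma m) ^+ 2 / 8)).
have t12 : 2 * t <= t2 m + t3 m by rewrite t2E /t3 /t; lra.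
have t0 : 0 <= t by rewrite /t; lra.
have k0 : 0 < 1 - t by lra.
apply: (@le_trans _ _
  ((delta m / 2)%:E * sup_dlog f (delta m) y x - (ln (1 - t))%:E)%E).
  apply: (ln_ratio_le_sup f0 df) => // c c0 cf'.
  apply: model4_ge => //; left.
  have -> : 1 - t =
      1 - expR (- ((delta m / sigma m) ^+ 2 / 8)) - 2 * h m * normal_peak (sigma m).
    by rewrite /t; ring.
  apply: (@mix_lower_far _ (f ^~ x) (fun j => A m j x)) => //.
  - exact: f0.
  - exact: df.
  - exact: f1.
  - exact: (scheme_partition hA).
  - by move=> j jm; exact: (scheme_cell_interval hA).
  - exact: (scheme_fine_interval hA).
  - by move=> j jm; exact: (scheme_cell_length hA).
  - by move=> j jm; exact: (scheme_center hA).
  - exact: ltW.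
rewrite leeD2l// -EFinN lee_fin (le_trans _ t12)// lnN_1B_le//; lra.
Qed.

(** The same constant k = phi(y, 0, sigma_0) r/2 serves for y in the tail cell,
    where it comes from the last component, and for y in the fine part, where it
    is below 1/4; - ln k is the bracket in the last term of the bound. *)
Lemma log_ratio_near m x y : (0 < m)%N -> X x ->
  t2 m <= 2^-1 -> 2 * sigma m <= r / 2 -> 2^-1 <= m%:R * p m ->
  Num.sqrt (2 * pi) * sigma m <= 2 * r * expR (- 2) ->
  ((ln (f y x / model4 f A mu sigma sigma0 m y x))%:E <=
   (r / 2)%:E * sup_dlog f r y x
   + (y ^+ 2 / (2 * sigma0 ^+ 2) - ln (r / 2 / Num.sqrt (2 * pi * sigma0 ^+ 2)))%:E)%E.
Proof.
move=> m0 Xx h_small s_small mp_large s_tiny; have [h0 d0 s0] := hpos m0.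
have /andP[p0 _] := ha_p m0.
have sq0 : 0 < Num.sqrt (2 * pi : R) by rewrite sqrtr_gt0 mulr_gt0// pi_gt0.
have phi0 : 0 < normal_pdf 0 sigma0 y.
  have s1 : sigma0 != 0 by rewrite gt_eqF.
  by rewrite (normal_pdfE _ s1) mulr_gt0 ?normal_peak_gt0// expR_gt0.
rewrite -ln_normal_pdf_tail//.
apply: (ln_ratio_le_sup f0 df) => // [|c c0 cf']; first by rewrite mulr_gt0// divr_gt0.
apply: model4_ge => //.
have [Iy|nIy] := pselect (fine_part A m x y); last first.
  right; rewrite mulrCA mulrC ler_wpM2r ?normal_pdf_ge0//.
  apply: (@tail_mass_lower _ (f ^~ x) (fun j => A m j x) m _ _ _ _ _ c y r) => //.
  - exact: f0.
  - exact: df.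
  - exact: f1.
  - exact: (scheme_partition hA).
  - exact: (scheme_fine_interval hA).
  - by rewrite scheme_tailE.
left; apply: (@le_trans _ _ (c / 4)).
  by rewrite ler_wpM2l// ltW// hf.
apply: (@mix_lower_fine _ (f ^~ x) (fun j => A m j x) m (h m) (sigma m) (p m)
  (fun j => mu m j x) _ _ _ _ _ _ _ _ _ _ c y r) => //.
- exact: f0.
- exact: df.
- exact: f1.
- exact: (scheme_partition hA).
- by move=> j jm; exact: (scheme_cell_interval hA).
- exact: (scheme_fine_interval hA).
- by move=> j jm; exact: (scheme_cell_length hA).
- by move=> j jm; exact: (scheme_center hA).
- by move=> j jm; exact: ha_cells.
- exact: ltW.
- move: h_small; rewrite /t2 normal_peakE// => h_small.
  have : 0 <= h m / (Num.sqrt (2 * pi) * sigma m) by rewrite divr_ge0 ?mulr_ge0 ?sqrtr_ge0// ltW.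
  by lra.
- apply: (@le_trans _ _ (2^-1 * (expR (- 2) * normal_peak (sigma m)))).
    rewrite normal_peakE// mulrA ler_pdivlMr ?mulr_gt0//.
    rewrite ler_pdivrMl ?mulr_gt0//; lra.
  by rewrite ler_wpM2r// mulr_ge0 ?expR_ge0// normal_peak_ge0.
Qed.

End scheme.

(** * Integration over the joint law *)

Section integral_lemmas.
Local Open Scope ereal_scope.
Context d (T : measurableType d) (R : realType) (mu : {measure set T -> \bar R}).
Implicit Types (D : set T) (f g : T -> \bar R).

(** The positive part of f is below g, and the integral of a nonnegative
    function is the supremum over the simple functions below it, which grows
    with the function even in the absence of measurability. *)
Lemma le_integral_ge0_bound D f g : (forall x, D x -> 0 <= g x) ->
  (forall x, D x -> f x <= g x) ->
  \int[mu]_(x in D) f x <= \int[mu]_(x in D) g x.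
Proof.
move=> g0 fg.
have fp0 : forall x, D x -> 0 <= f^\+ x by move=> x _; exact: funepos_ge0.
apply: (@le_trans _ _ (\int[mu]_(x in D) f^\+ x)).
  rewrite integralE geeDl// oppe_le0; apply: integral_ge0 => x _.
  exact: funeneg_ge0.
rewrite !ge0_integralE//; apply: le_ereal_sup => _ [k /= kf <-]; exists k => //= x.
apply: (le_trans (kf x)); rewrite !patchE; case: ifPn => // /[!inE] Dx.
by rewrite funeposE ge_max fg// g0.
Qed.

Lemma integral_vanishing D (N : nat -> set T) g : measurable D ->
  (forall m, measurable (N m)) -> (forall m, N m `<=` D) ->
  mu.-integrable D g ->
  (forall z, D z -> \forall m \near \oo, ~ N m z) ->
  \int[mu]_(z in N m) g z @[m --> \oo] --> 0.
Proof.
move=> mD mN ND ig evN.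
have mg : measurable_fun D g by case/integrableP: ig.
have mgN m : measurable_fun D (g \_ (N m)).
  apply/(measurable_restrict _ (mN m) mD); apply: measurable_funS mg => //.
have [||||_ _] := @dominated_convergence _ _ _ mu D mD
  (fun m => g \_ (N m)) (cst 0) (abse \o g) mgN.
- exact: measurable_cst.
- apply: aeW => z Dz; apply: cvg_near_cst; apply: filterS (evN z Dz) => m nN.
  by rewrite patchE memNset.
- exact: integrable_abse.
- apply: aeW => z m Dz; rewrite patchE; case: ifPn => // _.
  by rewrite [leLHS](_ : _ = 0) ?abse_ge0//; exact: abse0.
rewrite integral0.
under eq_fun do rewrite -integral_mkcondr (setIidr (ND _)).
by [].
Qed.

End integral_lemmas.

Section limits.
Context {R : realType}.

(** By exp v >= v, the left side is at most 8 u^2. *)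
Lemma cvg_expRN_inv_sq (u : nat -> R) : (forall n, (0 < n)%N -> 0 < u n) ->
  u n @[n --> \oo] --> (0 : R) ->
  expR (- ((u n)^-1 ^+ 2 / 8)) @[n --> \oo] --> (0 : R).
Proof.
move=> u0 cu.
apply: (@squeeze_cvgr _ _ _ _ (cst 0) (fun n => 8 * (u n * u n))).
- near=> n; have n0 : (0 < n)%N by near: n; exists 1%N.
  have un := u0 _ n0.
  rewrite expR_ge0/= expRN.
  have q0 : 0 < (u n)^-1 ^+ 2 / 8 by rewrite divr_gt0// exprn_gt0// invr_gt0.
  have -> : 8 * (u n * u n) = ((u n)^-1 ^+ 2 / 8)^-1.
    by field; rewrite gt_eqF.
  rewrite lef_pV2 ?posrE ?expR_gt0//.
  by have := expR_ge1Dx ((u n)^-1 ^+ 2 / 8); lra.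
- exact: cvg_cst.
- have := cvgM (cvg_cst (8 : R)) (cvgM cu cu); rewrite !mulr0; exact.
Unshelve. all: by end_near. Qed.
End limits.

Theorem corollary5p3 (R : realType) (dx : nat) (X : set (dx.-tuple R))
    (F : probability (R * dx.-tuple R)%type R)
    (f : R -> dx.-tuple R -> R)
    (nu : {measure set (dx.-tuple R) -> \bar R}) (fX : dx.-tuple R -> R)
    (A : nat -> nat -> dx.-tuple R -> set R)
    (mu : nat -> nat -> dx.-tuple R -> R)
    (h delta sigma p : nat -> R) (sigma0 r : R)
    (hF : has_densities X F f nu fX)
    (hA : partition_scheme X A h mu)
    (hpos : forall m, (0 < m)%N -> [/\ 0 < h m, 0 < delta m & 0 < sigma m])
    (hsigma0 : 0 < sigma0) (hr : 0 < r)
    (* (a) *)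
    (ha_p : forall m, (0 < m)%N -> 0 < p m <= m%:R^-1)
    (ha_cells : forall m j x, (0 < j <= m)%N -> X x ->
      cond_prob f (A m j x) x = p m)
    (ha_tail : forall m x, (0 < m)%N -> X x ->
      cond_prob f (A m 0%N x) x = 1 - m%:R * p m)
    (ha_lim : m%:R * p m @[m --> \oo] --> (1 : R))
    (* (b) *)
    (hb_delta : delta m @[m --> \oo] --> (0 : R))
    (hb_sigma : sigma m / delta m @[m --> \oo] --> (0 : R))
    (hb_h : h m / sigma m @[m --> \oo] --> (0 : R))
    (* (c) *)
    (hc_pos : forall x, X x -> forall y, 0 < f y x)
    (hc_diff : forall x, X x -> forall y, derivable (f ^~ x) y 1)
    (hc_cont : forall x, X x -> continuous (derive1 (f ^~ x)))
    (hc_moment : (\int[F]_(z in [set: R] `*` X) (z.1 ^+ 2)%:E < +oo)%E)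
    (* (d) *)
    (hd : forall y x, X x -> exists M : nat, forall m, (0 < m)%N -> (M <= m)%N ->
      (A m 0%N x y -> contains_interval_ending_at (r / 2) y
         (centered_interval r y `&` A m 0%N x)) /\
      (~ A m 0%N x y -> contains_interval_ending_at (r / 2) y
         (centered_interval r y `&` ~` A m 0%N x)))
    (* (e) *)
    (he : (\int[F]_(z in [set: R] `*` X) sup_dlog f r z.1 z.2 < +oo)%E)
    (* (f) *)
    (hf : forall y, normal_pdf 0 sigma0 y * (r / 2) < (4^-1 : R) < 1) :
  let T1 m := ((delta m * (Num.sqrt 1 / 2))%:E *
    \int[F]_(z in [set: R] `*` X) sup_dlog f (delta m) z.1 z.2)%E in
  let T2 m := 2 * (3 * h m / (Num.sqrt (2 * pi) * sigma m)) in
  let T3 m := 2 * expR (- ((delta m / sigma m) ^+ 2 / 8)) in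
  let T4 m := ((r / 2)%:E *
    \int[F]_(z in near_tail X A delta m) sup_dlog f r z.1 z.2)%E in
  let T5 m := (\int[F]_(z in near_tail X A delta m)
    (z.1 ^+ 2 / (2 * sigma0 ^+ 2)
     - ln (r / 2 / Num.sqrt (2 * pi * sigma0 ^+ 2)))%:E)%E in
  (exists M : nat, forall m, (M <= m)%N ->
     (dKL X F f (model4 f A mu sigma sigma0 m)
        <= T1 m + (T2 m)%:E + (T3 m)%:E + T4 m + T5 m)%E) /\
  [/\ T1 m @[m --> \oo] --> (0 : \bar R)%E,
      T2 m @[m --> \oo] --> (0 : R),
      T3 m @[m --> \oo] --> (0 : R),
      T4 m @[m --> \oo] --> (0 : \bar R)%E &
      T5 m @[m --> \oo] --> (0 : \bar R)%E].
Proof.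
move=> T1 T2 T3 T4 T5.
have [mX [mf _] fpos f1 _] := hF.
have hf' y : normal_pdf 0 sigma0 y * (r / 2) < 4^-1 by case/andP: (hf y).
pose D : set (R * dx.-tuple R) := [set: R] `*` X.
have mD : measurable D by exact: measurable_band.
pose N m := near_tail X A delta m.
have ND m : N m `<=` D by exact: near_tail_sub.
(* The scheme starts at m = 1, so the dominated convergence arguments run
   along m.+1. *)
have mN m : measurable (N m.+1) by exact: (measurable_near_tail hA hpos).
pose S a (z : R * dx.-tuple R) := sup_dlog f a z.1 z.2.
have mS a : 0 <= a -> measurable_fun D (S a).
  by move=> a0; exact: measurable_sup_dlog.
have S0 a z : 0 <= a -> (0 <= S a z)%E by exact: sup_dlog_ge0.
pose g (z : R * dx.-tuple R) : R :=
  z.1 ^+ 2 / (2 * sigma0 ^+ 2) - ln (r / 2 / Num.sqrt (2 * pi * sigma0 ^+ 2)).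
have g0 z : 0 <= g z.
  rewrite /g -ln_normal_pdf_tail// oppr_ge0 ln_le0//.
  by rewrite (le_trans (ltW (hf' _)))// invf_le1 ?ler1n.
have mg : measurable_fun D (EFin \o g).
  apply/measurable_EFinP/measurable_funTS; apply: measurable_funB => //.
  by apply: measurable_funM => //; apply: measurable_funX; exact: measurable_fst.
have Sint : F.-integrable D (S r).
  apply/integrableP; split; first by apply: mS; exact: ltW.
  under eq_integral do rewrite gee0_abs ?S0 ?ltW//.
  exact: he.
(* The second moment makes the bracket of the last term integrable. *)
have gint : F.-integrable D (EFin \o g).
  have m2 : measurable_fun D (fun z : R * dx.-tuple R => (z.1 ^+ 2)%:E).
    apply/measurable_EFinP/measurable_funTS.
    by apply: measurable_funX; exact: measurable_fst.
  have i2 : F.-integrable D (fun z => (z.1 ^+ 2)%:E).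
    apply/integrableP; split => //.
    under eq_integral do rewrite gee0_abs ?lee_fin ?sqr_ge0//.
    exact: hc_moment.
  pose c := ln (r / 2 / Num.sqrt (2 * pi * sigma0 ^+ 2)).
  have ic : F.-integrable D (cst c%:E) by exact: finite_measure_integrable_cst.
  apply: eq_integrable (integrableB mD (integrableZl mD (2 * sigma0 ^+ 2)^-1 i2) ic) => // z _.
  by rewrite /g /c /= -EFinM -EFinD mulrC.
have evN z : D z -> \forall m \near \oo, ~ N m.+1 z.
  move=> [_ Xz];
  have := eventually_not_near_tail f1 hA ha_tail ha_lim hb_delta hc_pos hc_diff Xz.
  by move=> [n _ H]; exists n => // m nm; apply: H; exact: leqW.
have T2cvg : T2 m @[m --> \oo] --> (0 : R).
  have := cvgM (cvg_cst (6 / Num.sqrt (2 * pi) : R)) hb_h; rewrite mulr0.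
  have E : cst (6 / Num.sqrt (2 * pi) : R) \* (fun m => h m / sigma m) = T2.
    by apply/funext => m; rewrite /T2 /= invfM; ring.
  rewrite E; exact.
have T3cvg : T3 m @[m --> \oo] --> (0 : R).
  rewrite -(mulr0 2); apply: cvgM; first exact: cvg_cst.
  have u0 m : (0 < m)%N -> 0 < sigma m / delta m by move=> /hpos[_ ? ?]; rewrite divr_gt0.
  have := cvg_expRN_inv_sq u0 hb_sigma.
  by under eq_fun do rewrite invf_div.
have sigma_cvg : sigma m @[m --> \oo] --> (0 : R).
  have := cvgM hb_sigma hb_delta; rewrite mulr0 => /(_ _) cs.
  have E : {near \oo, (fun m => sigma m / delta m) \* delta =1 sigma}.
    near=> m; have /hpos[_ d0 _] : (0 < m)%N by near: m; exists 1%N.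
    by rewrite /= divfK// gt_eqF.
  exact: (cvg_trans (near_eq_cvg E) cs).
split; last split => //.
- have : \forall m \near \oo, (dKL X F f (model4 f A mu sigma sigma0 m)
        <= T1 m + (T2 m)%:E + (T3 m)%:E + T4 m + T5 m)%E.
    near=> m.
    have m0 : (0 < m)%N by near: m; exists 1%N.
    have [h0 d0 s0] := hpos _ m0.
    have t2s : T2 m <= 2^-1 by near: m; apply: (cvgr_le 0).
    have t3s : T3 m <= 2^-1 by near: m; apply: (cvgr_le 0).
    have ss : sigma m <= r / 4 by near: m; apply: (cvgr_le 0) => //; rewrite divr_gt0.
    have mp : 2^-1 <= m%:R * p m by near: m; apply: (cvgr_ge 1) => //; lra.
    have st : sigma m <= 2 * r * expR (- 2) / Num.sqrt (2 * pi).
      near: m; apply: (cvgr_le 0) => //.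
      by rewrite divr_gt0 ?sqrtr_gt0 ?mulr_gt0 ?expR_gt0 ?pi_gt0.
    have mNm : measurable (N m) by exact: (measurable_near_tail hA hpos).
    pose V z := ((delta m / 2)%:E * S (delta m) z)%E.
    pose W z := ((r / 2)%:E * S r z + (g z)%:E)%E.
    pose K := T2 m + T3 m.
    have K0 : 0 <= K.
      by rewrite addr_ge0// mulr_ge0 ?expR_ge0// divr_ge0 ?mulr_ge0 ?sqrtr_ge0// ltW.
    have V0 z : (0 <= V z)%E by rewrite mule_ge0 ?lee_fin ?divr_ge0 ?S0// ltW.
    have W1 z : (0 <= (r / 2)%:E * S r z)%E by rewrite mule_ge0 ?lee_fin ?divr_ge0 ?S0// ltW.
    have W0 z : (0 <= W z)%E by rewrite adde_ge0// lee_fin g0.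
    have mV : measurable_fun D V by apply: measurable_funeM; apply: mS; exact: ltW.
    have mW1 : measurable_fun D (fun z => (r / 2)%:E * S r z)%E.
      by apply: measurable_funeM; apply: mS; exact: ltW.
    have mW : measurable_fun D W by exact: emeasurable_funD.
    have mWN : measurable_fun D (W \_ (N m)).
      by apply/(measurable_restrict _ mNm mD); exact: measurable_funS mW.
    (* The far bound is imposed everywhere: its terms are nonnegative, so on
       the near-tail set they only weaken the near bound. *)
    have bound : (dKL X F f (model4 f A mu sigma sigma0 m) <=
        \int[F]_(z in D) (V z + K%:E + (W \_ (N m)) z))%E.
      apply: le_integral_ge0_bound => [z _|[y x] [_ /= Xx]].
        by rewrite !adde_ge0 ?lee_fin// erestrict_ge0.
      have [Nz|nNz] := pselect (N m (y, x)).
        rewrite patchE mem_set//.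
        apply: (@le_trans _ _ (W (y, x))); last by rewrite leeDr// adde_ge0 ?lee_fin.
        apply: (log_ratio_near f1 hA hpos hsigma0 hr ha_p ha_cells ha_tail
          hc_pos hc_diff hf') => //.
        - lra.
        - by rewrite mulrC -ler_pdivlMr// sqrtr_gt0 mulr_gt0// pi_gt0.
      rewrite patchE memNset// adde0.
      have K1 : K <= 1 by rewrite /K; lra.
      exact: (log_ratio_far sigma0 f1 hA hpos ha_p ha_cells ha_tail
        hc_pos hc_diff m0 Xx nNz K1).
    apply: (le_trans bound).
    rewrite ge0_integralD//; last 3 first.
    - by move=> z _; rewrite adde_ge0.
    - by apply: emeasurable_funD.
    - by move=> z _; exact: erestrict_ge0.
    rewrite ge0_integralD// -integral_mkcondr (setIidr (ND m)).
    rewrite (@ge0_integralD _ _ _ F (N m))//; last 3 first.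
    - by apply: measurable_funS mW1.
    - by move=> z _; rewrite lee_fin g0.
    - by apply: measurable_funS mg.
    have intV : (\int[F]_(z in D) V z = T1 m)%E.
      rewrite /T1 sqrtr1 div1r ge0_integralZl_EFin ?divr_ge0 ?ltW//.
      - by move=> z _; rewrite S0// ltW.
      - by apply: mS; exact: ltW.
    have intW : (\int[F]_(z in N m) ((r / 2)%:E * S r z) = T4 m)%E.
      rewrite ge0_integralZl_EFin ?divr_ge0 ?ltW//.
      - by move=> z _; rewrite S0// ltW.
      - by apply: (measurable_funS mD) (ND m) _; apply: mS; exact: ltW.
    rewrite intV intW integral_cst// -/(T5 m) -!addeA leeD2l//.
    rewrite (addeA (T2 m)%:E) -EFinD leeD2r//.
    by rewrite -[leRHS]mule1 lee_wpmul2l ?lee_fin// probability_le1.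
  by case=> M _ HM; exists M.
- pose C := fine (\int[F]_(z in D) S r z)%E.
  have CE : (\int[F]_(z in D) S r z = C%:E)%E.
    by rewrite fineK//; exact: integrable_fin_num.
  apply: (@squeeze_cvge _ _ _ _ (cst 0%E) _ (fun m => (delta m / 2 * C)%:E)).
  + near=> m.
    have /hpos[_ d0 _] : (0 < m)%N by near: m; exists 1%N.
    have dr : delta m <= r by near: m; apply: (cvgr_le 0).
    rewrite /T1 sqrtr1 div1r; apply/andP; split.
      apply: mule_ge0; first by rewrite lee_fin divr_ge0 ?ltW.
      by apply: integral_ge0 => z _; rewrite S0// ltW.
    rewrite [leRHS]EFinM -CE; apply: lee_wpmul2l; first by rewrite lee_fin divr_ge0 ?ltW.
    apply: le_integral_ge0_bound => z _; first by rewrite S0// ltW.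
    exact: le_sup_dlog.
  + exact: cvg_cst.
  + apply: cvg_EFin; first exact: nearW.
    have := cvgM hb_delta (cvg_cst (2^-1 * C)); rewrite mul0r.
    have -> : delta \* cst (2^-1 * C) = (fun m => delta m / 2 * C).
      by apply/funext => m; rewrite /= mulrA.
    exact.
- have T4cvg : (\int[F]_(z in N m.+1) S r z @[m --> \oo] --> 0)%E.
    exact: (integral_vanishing mD mN).
  have r2 : (r / 2)%:E \is a fin_num by [].
  by rewrite -cvg_shiftS; have := cvgeZl r2 T4cvg; rewrite mule0; exact.
- rewrite -cvg_shiftS.
  exact: (integral_vanishing mD mN (fun m => @ND m.+1) gint evN).
Unshelve. all: by end_near. Qed.
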